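(* Let $V_0,\dots,V_d\colon\mathbb{R}^n\to\mathbb{R}^n$ be vector fields, let $\psi$ be an admissible weight function on $\mathbb{R}^n$, and assume that, for some constant $C>0$ and all $x\in\mathbb{R}^n$, $$\lvert V_iV_j\psi(x)\rvert+\lvert V_i\psi(x)\rvert\le C\psi(x)\quad\text{for } i=0,\dots,d\text{ and }j=1,\dots,d,$$ where all the necessary derivatives are required to be well-defined. Then there exists a constant $\tilde C>0$ independent of $\Delta t>0$ such that for all $\Delta t>0$ and $x\in\mathbb{R}^n$, $$Q_{(\Delta t)}\psi(x)\le\exp(\tilde C\Delta t)\psi(x).$$
   Context: **Notation.** An admissible weight function on $\mathbb{R}^n$ is a function $\psi\colon\mathbb{R}^n\to(0,\infty)$ such that $\{x:\psi(x)\le R\}$ is compact for all $R>0$. Vector fields act on functions by $V_ig(x):=Dg(x)(V_i(x))$. **Cubature.** Fix a cubature formula on Wiener space of order $m\ge1$ for $d$-dimensional Brownian motion $(B^j)_{j=1,\dots,d}$ on $[0,1]$: weights $\lambda_i>0$ and continuous paths of bounded variation $\omega^{(1)}_i=(\omega^{(1),j}_i)_{j=0,\dots,d}$ starting at $0$, $i=1,\dots,N$, with $\omega^{(1),0}_i(s)=s$, such that for all multi-indices $(j_1,\dots,j_k)\in\{0,\dots,d\}^k$, $k\ge0$, with $k+\#\{i:j_i=0\}\le m$, $$\mathbb{E}\Big[\int\cdots\int_{0\le s_1\le\dots\le s_k\le1}\circ dB^{j_1}_{s_1}\cdots\circ dB^{j_k}_{s_k}\Big]=\sum_{i=1}^N\lambda_i\int\cdots\int_{0\le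 s_1\le\dots\le s_k\le1}d\omega_i^{(1),j_1}(s_1)\cdots d\omega_i^{(1),j_k}(s_k),$$ where $B^0_t:=t$, $\circ dB^0_t:=dt$, and $\circ$ denotes Stratonovich integration (for $k=0$: $\sum_i\lambda_i=1$). For $\Delta t>0$ set on $[0,\Delta t]$: $\omega^{(\Delta t),0}_i(s)=s$ and $\omega^{(\Delta t),j}_i(s)=\sqrt{\Delta t}\,\omega^{(1),j}_i(s/\Delta t)$, $j=1,\dots,d$. **Approximation operator.** $X^x_s(\omega_i^{(\Delta t)})$, $s\in[0,\Delta t]$, denotes the solution of $$dX^x_s(\omega^{(\Delta t)}_i)=\sum_{j=0}^dV_j(X^x_s(\omega^{(\Delta t)}_i))\,d\omega^{(\Delta t),j}_i(s),\quad X^x_0(\omega^{(\Delta t)}_i)=x,$$ and $Q_{(\Delta t)}f(x):=\sum_{i=1}^N\lambda_if(X^x_{\Delta t}(\omega^{(\Delta t)}_i))$ for $f\colon\mathbb{R}^n\to\mathbb{R}$. *)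

(* Defs.v *)
From HB Require Import structures.
From mathcomp Require Import all_boot all_order all_algebra.
From mathcomp Require Import all_classical all_reals all_analysis.
From mathcomp Require Import lra.

Set Implicit Arguments.
Unset Strict Implicit.
Unset Printing Implicit Defensive.

Import Order.TTheory GRing.Theory Num.Theory.
Import numFieldNormedType.Exports.

Local Open Scope classical_set_scope.
Local Open Scope ring_scope.

Section Partitions.
Context {R : realType}.
Implicit Types (a b delta : R) (s : seq R).

(* For [itv_partition a b s] these are the nodes a = t_0 < t_1 < ... = b. *)
Definition node a b s (k : nat) : R := nth b (a :: s) k.

Definition fine_partition a b delta : set (seq R) :=
  [set s | itv_partition a b s /\ path (fun u v => v - u < delta) a s].

(* "As the mesh tends to 0". *)
Definition partitions a b : set_system (seq R) :=
  filter_from [set delta : R | 0 < delta] (fine_partition a b).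

Definition fine_tagged_partition a b delta : set (seq R * (nat -> R)) :=
  [set p | fine_partition a b delta p.1 /\
     forall k, (k < size p.1)%N ->
       node a b p.1 k <= p.2 k <= node a b p.1 k.+1].

Definition tagged_partitions a b : set_system (seq R * (nat -> R)) :=
  filter_from [set delta : R | 0 < delta] (fine_tagged_partition a b).

Lemma fine_partitionS a b d1 d2 s : d1 <= d2 ->
  fine_partition a b d1 s -> fine_partition a b d2 s.
Proof.
move=> d12 [abs fs]; split => //.
by apply: sub_path fs => u v uv; exact: lt_le_trans uv d12.
Qed.

Lemma fine_partition_ex a b delta : a <= b -> 0 < delta ->
  fine_partition a b delta !=set0.
Proof.
move=> ab d0.
have step n : forall a, a <= b -> b - a <= n%:R * (delta / 2) ->
    fine_partition a b delta !=set0.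
  elim: n => [|n IH] {ab}a ab bn.
    exists [::]; split => //; rewrite /itv_partition/=; split => //.
    by apply/eqP/le_anti/andP; split => //; lra.
  have [bad|bad] := leP (b - a) (delta / 2).
    have [<-|neq] := eqVneq a b.
      by exists [::]; split => //; rewrite /itv_partition/=.
    exists [:: b]; split; last by rewrite /= andbT; lra.
    by apply: itv_partition1; rewrite lt_neqAle neq.
  have [||s [[ps ls] fs]] := IH (a + delta / 2).
  - lra.
  - by move: bn; rewrite -natr1 mulrDl mul1r; lra.
  exists (a + delta / 2 :: s); split; first split => //=.
  - by rewrite ps andbT; lra.
  - by rewrite /= fs andbT; lra.
have d2 : 0 < delta / 2 by lra.
apply: (step (Num.truncn ((b - a) / (delta / 2))).+1) => //.
by rewrite -ler_pdivrMr// ltW// truncnS_gt.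
Qed.

Lemma partitions_proper a b : a <= b -> ProperFilter (partitions a b).
Proof.
move=> ab; apply: (filter_from_proper (filter_from_filter _ _)).
- by exists 1 => /=.
- move=> d1 d2 /= d10 d20; exists (Num.min d1 d2); first by rewrite /= lt_min d10.
  by move=> s fs; split; apply: fine_partitionS fs; rewrite ge_min lexx ?orbT.
- by move=> d /= d0; exact: fine_partition_ex.
Qed.

Lemma tagged_partitions_proper a b : a <= b ->
  ProperFilter (tagged_partitions a b).
Proof.
move=> ab; apply: (filter_from_proper (filter_from_filter _ _)).
- by exists 1 => /=.
- move=> d1 d2 /= d10 d20; exists (Num.min d1 d2); first by rewrite /= lt_min d10.
  move=> s [fs ts].
  by split; split => //; apply: fine_partitionS fs; rewrite ge_min lexx ?orbT.
- move=> d /= d0; have [s [[ps ls] fs]] := fine_partition_ex ab d0.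
  exists (s, node a b s); split => //= k ks; rewrite lexx /=.
  exact/ltW/(pathP b ps).
Qed.

End Partitions.

Section RiemannStieltjes.
Context {R : realType} {E : normedModType R}.
Implicit Types (f : R -> E) (g : R -> R) (a b : R).

Definition RS_sum f g a b (p : seq R * (nat -> R)) : E :=
  \sum_(k < size p.1) (g (node a b p.1 k.+1) - g (node a b p.1 k)) *: f (p.2 k).

Definition RS_integrable f g a b : Prop :=
  cvg (RS_sum f g a b p @[p --> tagged_partitions a b]).

(* The Riemann-Stieltjes integral of f against dg over [a, b]. *)
Definition RS_integral f g a b : E :=
  lim (RS_sum f g a b p @[p --> tagged_partitions a b]).

End RiemannStieltjes.

(* The integral of d om^{j_1}(s_1) ... d om^{j_k}(s_k) over
   0 <= s_1 <= ... <= s_k <= t, where al = [:: j_1; ...; j_k]. *)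
Definition path_iterated {R : realType} {d : nat} (om : 'I_d.+1 -> R -> R)
    (al : seq 'I_d.+1) : R -> R :=
  foldl (fun (I : R -> R) j t => RS_integral (I : R -> R^o) (om j) 0 t)
    (fun=> 1) al.

Section BrownianMotion.
Context {dO : measure_display} {Omega : measurableType dO} {R : realType}.
Variable P : probability Omega R.

(* As some of the sets A i may be setT, this yields the product rule for every
   subfamily. *)
Definition mutually_independent (I : finType) (X : I -> Omega -> R) : Prop :=
  forall A : I -> set R, (forall i, measurable (A i)) ->
    P (\bigcap_(i in [set: I]) X i @^-1` A i) =
    (\prod_(i : I) P (X i @^-1` A i))%E.

(* d-dimensional standard Brownian motion on [0, 1]; values at other times are
   never used. *)
Record is_brownian_motion {d : nat} (B : 'I_d -> R -> {RV P >-> R}) : Prop := {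
  bm_start : {ae P, forall w, forall j, B j 0 w = 0} ;
  bm_continuous : {ae P, forall w, forall j,
    {within `[0, 1], continuous (fun t => B j t w)}} ;
  bm_gaussian : forall j s t, 0 <= s -> s < t -> t <= 1 ->
    forall A : set R, measurable A ->
      P [set w | A (B j t w - B j s w)] = normal_prob 0 (Num.sqrt (t - s)) A ;
  bm_independent : forall s : seq R, itv_partition 0 1 s ->
    mutually_independent (fun (p : 'I_d * 'I_(size s)) w =>
      B p.1 (node 0 1 s p.2.+1) w - B p.1 (node 0 1 s p.2) w) }.

(* B^0_t = t; the coordinates 1, ..., d are [lift ord0 j] with j : 'I_d. *)
Definition with_time {d : nat} (B : 'I_d -> R -> {RV P >-> R})
    (j : 'I_d.+1) (t : R) (w : Omega) : R :=
  if unlift ord0 j is Some j' then B j' t w else t.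

Definition trapezoid_sum (Y Z : R -> Omega -> R) (a b : R) (s : seq R)
    (w : Omega) : R :=
  \sum_(k < size s) (Y (node a b s k) w + Y (node a b s k.+1) w) / 2
                    * (Z (node a b s k.+1) w - Z (node a b s k) w).

(* J_t is the Stratonovich integral of Y against dZ over [0, t], for all t in
   [0, 1]: the limit in probability of the trapezoidal sums as the mesh of
   the (deterministic) partition tends to 0. For Z_t = t and continuous Y this
   is the integral of Y_s ds. *)
Definition is_stratonovich_integral (Y Z : R -> Omega -> R)
    (J : R -> {RV P >-> R}) : Prop :=
  forall t, 0 <= t <= 1 -> forall eps : R, 0 < eps ->
    P [set w | eps <= `|trapezoid_sum Y Z 0 t s w - J t w|]
      @[s --> partitions 0 t] --> 0%E.

(* J_t is the integral of odB^{j_1}_{s_1} ... odB^{j_k}_{s_k} over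
   0 <= s_1 <= ... <= s_k <= t, where the multi-index is [:: j_1; ...; j_k];
   it is determined up to a null set for every t. *)
Inductive stratonovich_iterated {d : nat} (B : 'I_d -> R -> {RV P >-> R}) :
    seq 'I_d.+1 -> (R -> {RV P >-> R}) -> Prop :=
| stratonovich_iterated_nil (J : R -> {RV P >-> R}) :
    (forall t w, 0 <= t <= 1 -> J t w = 1) ->
    stratonovich_iterated B [::] J
| stratonovich_iterated_rcons al j (I J : R -> {RV P >-> R}) :
    stratonovich_iterated B al I ->
    is_stratonovich_integral I (with_time B j) J ->
    stratonovich_iterated B (rcons al j) J.

Definition multi_degree {d : nat} (al : seq 'I_d.+1) : nat :=
  (size al + count_mem ord0 al)%N.

(* Cubature formula on Wiener space of order m with N paths. *)
Record is_cubature {d : nat} (B : 'I_d -> R -> {RV P >-> R}) (m N : nat)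
    (lam : 'I_N -> R) (om : 'I_N -> 'I_d.+1 -> R -> R) : Prop := {
  cub_weight_gt0 : forall i, 0 < lam i ;
  cub_continuous : forall i j, {within `[0, 1], continuous (om i j)} ;
  cub_bounded_variation : forall i j, bounded_variation 0 1 (om i j) ;
  cub_start : forall i j, om i j 0 = 0 ;
  cub_time : forall i s, 0 <= s <= 1 -> om i ord0 s = s ;
  cub_moments : forall (al : seq 'I_d.+1) (J : R -> {RV P >-> R}),
    (multi_degree al <= m)%N -> stratonovich_iterated B al J ->
    ('E_P[J 1%R] = (\sum_(i < N) lam i * path_iterated (om i) al 1)%R%:E)%E }.

End BrownianMotion.

Arguments is_brownian_motion {dO Omega R} P {d} B.
Arguments is_cubature {dO Omega R} P {d} B m {N} lam om.

Section ApproximationOperator.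
Context {R : realType} {n d : nat}.

Definition admissible_weight (psi : 'rV[R]_n -> R) : Prop :=
  (forall x, 0 < psi x) /\
  (forall r : R, 0 < r -> compact [set x | psi x <= r]).

Definition vf_apply (V : 'rV[R]_n -> 'rV[R]_n) (g : 'rV[R]_n -> R) :
    'rV[R]_n -> R :=
  fun x => 'd (g : 'rV[R]_n -> R^o) x (V x).

Definition scaled_path (om : 'I_d.+1 -> R -> R) (Dt : R) (j : 'I_d.+1) (s : R) :
    R :=
  if j == ord0 then s else Num.sqrt Dt * om j (s / Dt).

(* X solves dX_s = sum_j V_j(X_s) d om^j(s) on [0, T] with X_0 = x. *)
Definition is_solution (V : 'I_d.+1 -> 'rV[R]_n -> 'rV[R]_n)
    (om : 'I_d.+1 -> R -> R) (T : R) (x : 'rV[R]_n) (X : R -> 'rV[R]_n) : Prop :=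
  [/\ {within `[0, T], continuous X},
      X 0 = x &
      forall t, 0 <= t <= T ->
        (forall j, RS_integrable (V j \o X) (om j) 0 t) /\
        X t = x + \sum_(j < d.+1) RS_integral (V j \o X) (om j) 0 t].

(* [X i Dt x s] stands for X^x_s(om_i^{(Dt)}). *)
Definition Q {N : nat} (lam : 'I_N -> R)
    (X : 'I_N -> R -> 'rV[R]_n -> R -> 'rV[R]_n) (Dt : R) (f : 'rV[R]_n -> R)
    (x : 'rV[R]_n) : R :=
  \sum_(i < N) lam i * f (X i Dt x Dt).

End ApproximationOperator.

(* Main.v *)
Require Import Defs.
From mathcomp Require Import all_boot all_order all_algebra.
From mathcomp Require Import all_classical all_reals all_analysis.
From mathcomp Require Import measurable_realfun ring lra.
Import Order.TTheory GRing.Theory Num.Theory.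
Import numFieldNormedType.Exports.
Local Open Scope classical_set_scope.
Local Open Scope ring_scope.
Set Implicit Arguments.
Unset Strict Implicit.
Unset Printing Implicit Defensive.

(** The idea is a Taylor expansion of [psi] along each cubature path, of which
    only the time direction and the second-order terms survive the averaging.

    Write r for the square root of Dt, phi_j for V_j psi, and X for a solution
    along a rescaled cubature path. That path has total variation Dt + O(r),
    the noise directions accounting for O(r). Since |V_j psi| <= C psi, the
    logarithm of [psi] grows along X at most by C times the variation, hence
    psi <= exp (C (Dt + O(r))) psi(x) all along X ([weight_growth]). When
    Dt >= 1 we have r <= Dt, and this alone gives the claim for every single
    path ([long_step_weight_le]).

    When Dt <= 1, the same argument applied to phi_j, whose derivatives in the
    directions V_i are bounded by C psi, shows that phi_j stays within
    O(r) psi(x) of phi_j(x) ([directional_weight_oscillation]). Therefore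
    psi(X) - psi(x) differs from sum_(j >= 1) phi_j(x) (increment of the j-th
    driver) by at most O(Dt) psi(x) from the time direction plus
    O(r) * O(r) psi(x) from the noise directions ([weight_second_order]).
    Averaged over the cubature formula, the first-order terms cancel, since
    sum_i lambda_i omega_i^j(1) = E[B^j_1] = 0 ([cubature_first_moment]), and
    what remains is (1 + O(Dt)) psi(x) <= exp (O(Dt)) psi(x).

    The functions psi and phi_j are differentiable but need not be C^1, so the
    fundamental theorem of calculus does not apply to psi(X). Everything is
    thus reduced to one mean value inequality ([chain_increment_le]). At each
    single time c, freezing the vector fields at X_c gives
    g(X_s) - g(X_c) = sum_j V_j g(X_c) (om_j(s) - om_j(c)) + o(v(s) - v(c)),
    where v is the variation of the drivers ([chain_local_expansion]); and a
    bound that holds near every point, with the increments of a nondecreasing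
    function on the right, holds globally ([dist_le_of_local_dist_le]). *)

(** * From local to global increments *)

(** Mean value inequality without derivatives: the set of times up to which the
    bound holds contains its supremum, because the local bound applies just
    before it, and reaches beyond it, because the local bound applies just
    after it. *)
Lemma dist_le_of_local_dist_le (R : realType) (E : normedModType R)
    (F : R -> E) (H : R -> R) (a b : R) : a <= b ->
  (forall u w, a <= u -> u <= w -> w <= b -> H u <= H w) ->
  (forall c, a <= c <= b ->
    \forall s \near c, a <= s <= b -> `|F s - F c| <= `|H s - H c|) ->
  `|F b - F a| <= H b - H a.
Proof.
move=> ab Hnd loc.
pose S := [set t | a <= t <= b /\ `|F t - F a| <= H t - H a].
have Sa : S a by split; rewrite ?lexx ?ab// !subrr normr0.
have supS : has_sup S.
  by split; [exists a | exists b => t [/andP[]]].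
set c := sup S.
have ac : a <= c by exact: sup_upper_bound.
have cb : c <= b by apply: ge_sup; [exists a | move=> t [/andP[]]].
have /nbhs_ballP[r /= r0 locc] := loc c ltac:(by rewrite ac cb).
have extend s t : a <= s -> s <= t -> t <= b ->
    `|F t - F s| <= `|H t - H s| -> S s -> S t.
  move=> as_ st tb Fst [_ Fs]; split; first by rewrite (le_trans as_ st).
  move: Fst; rewrite ger0_norm ?subr_ge0 ?Hnd// => Fst.
  have -> : F t - F a = (F t - F s) + (F s - F a) by rewrite addrA subrK.
  by rewrite (le_trans (ler_normD _ _))//; lra.
have Sc : S c.
  have [t St ct] := sup_adherent r0 supS.
  have tc : t <= c by exact: sup_upper_bound.
  have [/andP[at_ tb] _] := St.
  apply: (extend t) => //; rewrite distrC (distrC (H c)); apply: locc => //=.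
    by rewrite /ball/= ger0_norm ?subr_ge0// /c; lra.
  by rewrite at_ tb.
have [cltb|bc] := ltP c b; last first.
  have <- : c = b by apply: le_anti; rewrite cb bc.
  by case: Sc.
pose s := Num.min b (c + r / 2).
have cs : c < s by rewrite lt_min cltb/=; lra.
have sb : s <= b by rewrite ge_min lexx.
have sr : s <= c + r / 2 by rewrite ge_min lexx orbT.
have : S s.
  apply: (extend c) => //; first exact: ltW.
  apply: locc; last by rewrite sb (le_trans ac)// ltW.
  by rewrite /= /ball/= distrC ger0_norm ?subr_ge0 ?(ltW cs)//; lra.
by move=> /(sup_upper_bound supS); rewrite leNgt cs.
Qed.

(** * Increments of Riemann-Stieltjes integrals *)

Section tagged_partition_concatenation.
Context {R : realType} {E : normedModType R}.
Implicit Types (a b c : R) (p q : seq R * (nat -> R)).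

Definition tagged_cat p q : seq R * (nat -> R) :=
  (p.1 ++ q.1,
   fun k => if (k < size p.1)%N then p.2 k else q.2 (k - size p.1)%N).

Lemma node_catl a b c (s t : seq R) k : itv_partition a b s ->
  (k <= size s)%N -> node a c (s ++ t) k = node a b s k.
Proof.
move=> abs ks; rewrite /node -cat_cons nth_cat /= ltnS ks.
by apply: set_nth_default; rewrite /= ltnS.
Qed.

Lemma node_catr a b c (s t : seq R) k : itv_partition a b s ->
  node a c (s ++ t) (size s + k) = node b c t k.
Proof.
move=> abs; rewrite /node -cat_cons nth_cat /= ltnS.
case: k => [|k] /=.
  rewrite addn0 leqnn /= -(itv_partition_nth_size b abs).
  by apply: set_nth_default.
by rewrite addnS ltnNge leq_addr /= subSS addKn.
Qed.

Lemma fine_tagged_partition_cat a b c delta p q :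
  fine_tagged_partition a b delta p -> fine_tagged_partition b c delta q ->
  fine_tagged_partition a c delta (tagged_cat p q).
Proof.
move=> [[abp fp] tp] [[bcq fq] tq]; split => /=.
  split; first exact: itv_partition_cat abp bcq.
  by rewrite cat_path fp; case: abp => _ /eqP ->.
move=> k; rewrite size_cat => kpq; case: ltnP => kp.
  by rewrite !(node_catl _ _ abp) ?tp// ltnW.
have -> : k = (size p.1 + (k - size p.1))%N by rewrite subnKC.
rewrite -addnS !(node_catr _ _ _ abp) addKn; apply: tq.
by rewrite ltn_subLR.
Qed.

Lemma RS_sum_cat (f : R -> E) (g : R -> R) a b c p q :
  itv_partition a b p.1 ->
  RS_sum f g a c (tagged_cat p q) = RS_sum f g a b p + RS_sum f g b c q.
Proof.
move=> abp; rewrite /RS_sum /= size_cat big_split_ord /=; congr +%R.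
  apply: eq_bigr => k _ /=.
  by rewrite !(node_catl _ _ abp) ?ltn_ord// ltnW.
apply: eq_bigr => k _ /=.
by rewrite ltnNge leq_addr /= addKn -addnS !(node_catr _ _ _ abp).
Qed.

End tagged_partition_concatenation.

(** All that the estimates use of the total variation function of [g]. *)
Definition dominates_increments {R : realType} (a b : R) (v g : R -> R) :=
  forall u w, a <= u -> u <= w -> w <= b -> `|g w - g u| <= v w - v u.

Lemma telescope_node (R : realType) (E : zmodType) (h : R -> E) a b
    (s : seq R) : itv_partition a b s ->
  \sum_(k < size s) (h (node a b s k.+1) - h (node a b s k)) = h b - h a.
Proof.
move=> abs; rewrite -(big_mkord predT (fun k => h (node a b s k.+1) - h (node a b s k))).
rewrite telescope_sumr//; congr (h _ - h _).
exact: itv_partition_nth_size abs.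
Qed.

Section Riemann_Stieltjes_increment.
Context {R : realType} {E : normedModType R}.
Variables (f : R -> E) (g v : R -> R).
Implicit Types (a b c delta : R) (p : seq R * (nat -> R)).

(** Frozen at the value [y], the sum telescopes; the error is weighted by the
    increments of [g], which add up to at most those of [v]. *)
Lemma RS_sum_freeze a b delta p (y : E) eps :
  dominates_increments a b v g ->
  fine_tagged_partition a b delta p ->
  (forall u, a <= u <= b -> `|f u - y| <= eps) ->
  `|RS_sum f g a b p - (g b - g a) *: y| <= eps * (v b - v a).
Proof.
move=> dom [[abp fp] tp] fy.
rewrite -(telescope_node g abp) -(telescope_node v abp) scaler_suml.
rewrite mulr_sumr /RS_sum -sumrB (le_trans (ler_norm_sum _ _ _))//.
apply: ler_sum => k _; rewrite -scalerBr normrZ mulrC.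
have ak : a <= node a b p.1 k by apply: itv_partition_nth_ge => //; rewrite ltnS ltnW.
have kb : node a b p.1 k.+1 <= b by apply: itv_partition_nth_le => //; rewrite ltnS.
have /andP[t1 t2] := tp k (ltn_ord k).
apply: ler_pM => //.
  by apply: fy; rewrite (le_trans ak t1) (le_trans t2 kb).
by apply: dom => //; exact: le_trans t1 t2.
Qed.

Lemma RS_sum_near a b e : a <= b -> RS_integrable f g a b -> 0 < e ->
  exists2 delta, 0 < delta & forall p, fine_tagged_partition a b delta p ->
    `|RS_integral f g a b - RS_sum f g a b p| < e.
Proof.
move=> ab fg e0; have PF := tagged_partitions_proper ab.
have /cvgrPdist_lt/(_ e e0)[delta /= d0 H] := fg.
by exists delta.
Qed.

(** Comparing the sums on concatenated partitions from [a] to [s] and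
    from [s] to [t] gives the increment of the integral directly, without
    passing through the integral over the interval from [s] to [t]. *)
Lemma RS_integral_freeze a s t y eps : a <= s -> s <= t ->
  RS_integrable f g a s -> RS_integrable f g a t ->
  dominates_increments s t v g ->
  (forall u, s <= u <= t -> `|f u - y| <= eps) ->
  `|RS_integral f g a t - RS_integral f g a s - (g t - g s) *: y|
    <= eps * (v t - v s).
Proof.
move=> as_ st fgs fgt dom fy; apply/ler_addgt0Pr => e e0.
have e2 : 0 < e / 2 by lra.
have [d1 d10 H1] := RS_sum_near as_ fgs e2.
have [d2 d20 H2] := RS_sum_near (le_trans as_ st) fgt e2.
pose d := Num.min d1 d2.
have d0 : 0 < d by rewrite lt_min d10.
have tagged b c (bc : b <= c) : exists p, fine_tagged_partition b c d p.
  have PF := tagged_partitions_proper bc.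
  by apply: (@filter_ex _ (tagged_partitions b c)); exists d.
have [p fp] := tagged _ _ as_; have [q fq] := tagged _ _ st.
have weaken b c r d' : d <= d' -> fine_tagged_partition b c d r ->
    fine_tagged_partition b c d' r.
  by move=> dd' [fr tr]; split => //; exact: fine_partitionS fr.
have Hs := H1 p ltac:(by apply: weaken fp; rewrite ge_min lexx).
have Ht := H2 (tagged_cat p q) ltac:(by
  apply: weaken (fine_tagged_partition_cat fp fq); rewrite ge_min lexx orbT).
have abp : itv_partition a s p.1 by case: fp => -[].
rewrite (RS_sum_cat f g t q abp) in Ht.
have Hq := RS_sum_freeze dom fq fy.
set It := RS_integral f g a t in Ht *; set Is := RS_integral f g a s in Hs *.
set Sp := RS_sum f g a s p in Hs Ht; set Sq := RS_sum f g s t q in Ht Hq.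
set L := (g t - g s) *: y in Hq *.
have -> : It - Is - L = (It - (Sp + Sq)) - (Is - Sp) + (Sq - L).
  by rewrite (opprD Sp) (opprB Is) -(addrA It (- Sp - Sq)) (addrACA (- Sp)) addNr add0r
    -(addrA It (- Sq - Is)) (addrACA (- Sq)) addNr add0r addrA.
apply: le_trans (ler_normD _ _) _; rewrite addrC; apply: lerD => //.
apply: le_trans (ler_normB _ _) _; lra.
Qed.

End Riemann_Stieltjes_increment.

Lemma RS_integral_cst (R : realType) (g : R -> R) a b : a <= b ->
  RS_integral ((fun=> 1) : R -> R^o) g a b = g b - g a.
Proof.
move=> ab; have PF := tagged_partitions_proper ab.
apply: cvg_lim => //; apply: cvg_near_cst.
exists 1 => //= p [[abp _] _]; rewrite -(telescope_node g abp) /RS_sum.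
by apply: eq_bigr => k _; rewrite /GRing.scale /= mulr1.
Qed.

(** * Differentiable functions along a solution *)

Section expansion_along_solution.
Context {R : realType} {n d : nat}.
Variables (V : 'I_d.+1 -> 'rV[R]_n -> 'rV[R]_n) (om v : 'I_d.+1 -> R -> R).
Variables (T : R) (x : 'rV[R]_n) (X : R -> 'rV[R]_n).
Hypothesis contV : forall j, continuous (V j).
Hypothesis solX : is_solution V om T x X.
Hypothesis dom : forall j, dominates_increments 0 T (v j) (om j).

Let tv (s : R) := \sum_j v j s.

Let tvB s t : tv t - tv s = \sum_j (v j t - v j s).
Proof. by rewrite /tv -sumrB. Qed.

Lemma solution_continuous_at c : 0 <= c <= T ->
  X s @[s --> within `[0, T] (nbhs c)] --> X c.
Proof.
move=> c0T; have [/subspace_continuousP contX _ _] := solX.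
by apply: contX; rewrite /= in_itv.
Qed.

Lemma solution_increment_freeze s t (y : 'I_d.+1 -> 'rV[R]_n) eps :
  0 <= s -> s <= t -> t <= T ->
  (forall j u, s <= u <= t -> `|V j (X u) - y j| <= eps) ->
  `|X t - X s - \sum_j (om j t - om j s) *: y j| <= eps * (tv t - tv s).
Proof.
move=> s0 st tT Vy; have [_ _ eqX] := solX.
have [intt ->] := eqX t ltac:(by rewrite tT (le_trans s0 st)).
have [ints ->] := eqX s ltac:(by rewrite s0 (le_trans st tT)).
rewrite opprD addrACA subrr add0r -2!sumrB tvB mulr_sumr.
rewrite (le_trans (ler_norm_sum _ _ _))//; apply: ler_sum => j _.
apply: RS_integral_freeze => //; last exact: Vy.
move=> u w su uw wt; apply: dom => //; first exact: le_trans s0 su.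
exact: le_trans wt tT.
Qed.

(** Between [s] and [c] the fields [V j o X] stay within [eps] of their values
    at [c], so they can be frozen there, on either side of [c]. *)
Lemma solution_local_expansion (c eps : R) : 0 <= c <= T -> 0 < eps ->
  \forall s \near c, 0 <= s <= T ->
    `|X s - X c - \sum_j (om j s - om j c) *: V j (X c)|
      <= eps * `|tv s - tv c|.
Proof.
move=> c0T eps0.
have /nbhs_ballP[r /= r0 Vr] : \forall s \near c,
    0 <= s <= T -> forall j, `|V j (X s) - V j (X c)| <= eps.
  suff : \forall s \near within `[0, T] (nbhs c),
      forall j, `|V j (X s) - V j (X c)| <= eps.
    move=> H; have : nbhs c [set s | `[0, T]%classic s ->
      forall j, `|V j (X s) - V j (X c)| <= eps] := H.
    apply: filterS => s /= Hs s0T; apply: Hs.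
    by rewrite in_itv.
  apply: filter_forall => j.
  have : V j (X s) @[s --> within `[0, T] (nbhs c)] --> V j (X c).
    apply: (cvg_comp _ _ (solution_continuous_at c0T)); exact: contV.
  move=> /cvgrPdist_le /(_ _ eps0); apply: filterS => s.
  by rewrite distrC.
have [c0 cT] := andP c0T.
apply/nbhs_ballP; exists r => //= s; rewrite /ball/= => sc /andP[s0 sT].
have [cs|/ltW sc'] := leP c s.
  rewrite ger0_norm; last first.
    rewrite subr_ge0 -subr_ge0 tvB; apply: sumr_ge0 => j _.
    by apply: le_trans (dom j c0 cs sT).
  apply: solution_increment_freeze => // j u /andP[cu us]; apply: Vr.
    by rewrite /ball /= distrC ger0_norm ?subr_ge0//; move: sc;
      rewrite distrC ger0_norm ?subr_ge0//; lra.
  by rewrite (le_trans c0 cu) (le_trans us sT).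
rewrite [X in eps * X]ler0_norm; last first.
  rewrite -oppr_ge0 opprB tvB; apply: sumr_ge0 => j _.
  by apply: le_trans (dom j s0 sc' cT).
rewrite opprB.
have -> : X s - X c - \sum_j (om j s - om j c) *: V j (X c) =
    - (X c - X s - \sum_j (om j c - om j s) *: V j (X c)).
  rewrite [RHS]opprB opprB addrC; congr (_ + _); rewrite -sumrN.
  by apply: eq_bigr => j _; rewrite -scaleNr opprB.
rewrite normrN.
apply: solution_increment_freeze => // j u /andP[su uc]; apply: Vr.
  by rewrite /ball /= ger0_norm ?subr_ge0//; move: sc; rewrite ger0_norm ?subr_ge0//; lra.
by rewrite (le_trans s0 su) (le_trans uc cT).
Qed.

Lemma comonotone_sum_dist (K : 'I_d.+1 -> R) s c : (forall j, 0 <= K j) ->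
  0 <= s <= T -> 0 <= c <= T ->
  `|\sum_j K j * v j s - \sum_j K j * v j c| = \sum_j K j * `|v j s - v j c|.
Proof.
move=> K0.
wlog cs : s c / c <= s => [H s0T c0T|/andP[s0 sT] /andP[c0 cT]].
  have [cs|/ltW sc] := leP c s; first exact: H.
  by rewrite distrC H//; under eq_bigr do rewrite distrC.
have v0 j : 0 <= v j s - v j c by apply: le_trans (dom j c0 cs sT).
rewrite -sumrB ger0_norm; first by apply: eq_bigr => j _; rewrite ger0_norm// mulrBr.
by apply: sumr_ge0 => j _; rewrite -mulrBr mulr_ge0.
Qed.

Lemma driver_dist_le j s c : 0 <= s <= T -> 0 <= c <= T ->
  `|om j s - om j c| <= `|v j s - v j c|.
Proof.
wlog cs : s c / c <= s => [H s0T c0T|/andP[s0 sT] /andP[c0 cT]].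
  have [cs|/ltW sc] := leP c s; first exact: H.
  by rewrite distrC (distrC (v j s)) H.
by rewrite (le_trans (dom j c0 cs sT))// ler_norm.
Qed.

Lemma total_dist s c : 0 <= s <= T -> 0 <= c <= T ->
  `|tv s - tv c| = \sum_j `|v j s - v j c|.
Proof.
move=> s0T c0T; have tvE u : tv u = \sum_j 1 * v j u.
  by apply: eq_bigr => j _; rewrite mul1r.
rewrite !tvE comonotone_sum_dist//.
by apply: eq_bigr => j _; rewrite mul1r.
Qed.

Lemma sum_driver_dist_le s c : 0 <= s <= T -> 0 <= c <= T ->
  \sum_j `|om j s - om j c| <= `|tv s - tv c|.
Proof.
move=> s0T c0T; rewrite total_dist//; apply: ler_sum => j _.
exact: driver_dist_le.
Qed.

(** Differentiability at the single point [X c] is enough: the displacement of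
    [X] is itself O(|tv s - tv c|), so the error of the linear approximation of
    [g] is o(|tv s - tv c|). *)
Lemma chain_local_expansion (g : 'rV[R]_n -> R) (c eps : R) :
  0 <= c <= T -> 0 < eps -> differentiable (g : 'rV[R]_n -> R^o) (X c) ->
  \forall s \near c, 0 <= s <= T ->
    `|g (X s) - g (X c) - \sum_j (om j s - om j c) * vf_apply (V j) g (X c)|
      <= eps * `|tv s - tv c|.
Proof.
move=> c0T eps0 dg; pose D := 'd (g : 'rV[R]_n -> R^o) (X c).
have [M M0 DM] : exists2 M : R, 0 < M & forall h, `|D h| <= M * `|h|.
  have cD : continuous D by exact: diff_continuous.
  have /linear_bounded_continuous/linear_boundedP/pinfty_ex_gt0[M M0 H] := cD.
  by exists M.
pose S := \sum_j `|V j (X c)|.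
have S0 : 0 <= S by apply: sumr_ge0.
(* [eta] controls the linearization error of [g], multiplied by the bound
   [S + 1] on the speed of [X]; [eps'] controls the error of freezing the
   fields, multiplied by the bound [M] on [D]; each contributes [eps / 2]. *)
pose eta := eps / (2 * (S + 1)); pose eps' := Num.min 1 (eps / (2 * M)).
have eta0 : 0 < eta by rewrite divr_gt0// mulr_gt0//; lra.
have eps'0 : 0 < eps' by rewrite lt_min ltr01 divr_gt0// mulr_gt0.
have gD : \forall s \near c, 0 <= s <= T ->
    `|g (X s) - g (X c) - D (X s - X c)| <= eta * `|X s - X c|.
  have /diff_locally/eqaddoP/(_ _ eta0) := dg.
  rewrite /= nearE => Hg.
  have : X s - X c @[s --> within `[0, T] (nbhs c)] --> (0 : 'rV[R]_n).
    rewrite -(subrr (X c)); apply: cvgB; last exact: cvg_cst.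
    exact: solution_continuous_at.
  move=> /(_ _ Hg) H; have : nbhs c [set s | `[0, T]%classic s ->
    `|(((g \o shift (X c)) - (cst (g (X c)) + D)) : 'rV[R]_n -> R^o) (X s - X c)|
      <= eta * `|X s - X c| ] := H.
  apply: filterS => s /= Hs s0T.
  have := Hs ltac:(by rewrite in_itv).
  by rewrite !fctE /= subrK opprD addrA.
have XE := solution_local_expansion c0T eps'0.
apply: filterS2 XE gD => s + + s0T; move=> /(_ s0T) XE /(_ s0T) gD.
set W := \sum_j (om j s - om j c) *: V j (X c) in XE.
have DW : \sum_j (om j s - om j c) * vf_apply (V j) g (X c) = D W.
  by rewrite /W linear_sum; apply: eq_bigr => j _; rewrite linearZ.
have W_le : `|W| <= S * `|tv s - tv c|.
  rewrite (le_trans (ler_norm_sum _ _ _))// /S mulr_suml; apply: ler_sum => j _.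
  rewrite normrZ mulrC ler_wpM2l//.
  apply: le_trans (sum_driver_dist_le s0T c0T).
  by rewrite (bigD1 j)//= lerDl sumr_ge0.
have X_le : `|X s - X c| <= (S + 1) * `|tv s - tv c|.
  rewrite -(subrK W (X s - X c)) (le_trans (ler_normD _ _))// mulrDl addrC.
  by rewrite lerD// (le_trans XE)// ler_wpM2r// ge_min lexx.
rewrite DW (_ : _ - _ = (g (X s) - g (X c) - D (X s - X c)) + D (X s - X c - W)).
  rewrite (le_trans (ler_normD _ _))// [eps]splitr mulrDl lerD//.
    rewrite (le_trans gD)// (le_trans (ler_wpM2l (ltW eta0) X_le))// mulrA.
    by rewrite ler_wpM2r// /eta invfM mulrA mulfVK//; lra.
  rewrite (le_trans (DM _))// (le_trans (ler_wpM2l (ltW M0) XE))// mulrA.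
  rewrite ler_wpM2r// (@le_trans _ _ (M * (eps / (2 * M))))//.
    by rewrite ler_wpM2l ?(ltW M0)// ge_min lexx orbT.
  by rewrite invfM mulrCA (mulrCA M) divff ?mulr1// gt_eqF.
by rewrite (linearB D (X s - X c)) addrA subrK.
Qed.

(** The linear terms [a j] leave room for subtracting a first-order expansion
    with frozen coefficients; with [a = 0] this is the plain mean value
    inequality. The error [eps] of the local expansion is absorbed into the
    dominating function [H] and then sent to 0. *)
Lemma chain_increment_le (g : 'rV[R]_n -> R) (a K : 'I_d.+1 -> R) t :
  0 <= t <= T -> (forall y, differentiable (g : 'rV[R]_n -> R^o) y) ->
  (forall j u, 0 <= u <= t -> `|vf_apply (V j) g (X u) - a j| <= K j) ->
  `|g (X t) - g x - \sum_j a j * (om j t - om j 0)|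
    <= \sum_j K j * (v j t - v j 0).
Proof.
move=> /andP[t0 tT] dg gK.
have X0 : X 0 = x by case: solX.
have K0 j : 0 <= K j by apply: le_trans (gK j 0 _) => //; rewrite lexx.
have v_ge0 j : 0 <= v j t - v j 0 by apply: le_trans (dom j _ _ _).
apply/ler_addgt0Pr => e e0.
have tv0 : 0 <= tv t - tv 0 by rewrite tvB; apply: sumr_ge0.
pose eps := e / (tv t - tv 0 + 1).
have eps0 : 0 < eps by rewrite divr_gt0//; lra.
have Ke0 j : 0 <= K j + eps by rewrite addr_ge0// ltW.
pose F s : R^o := g (X s) - \sum_j a j * om j s.
pose H s := \sum_j (K j + eps) * v j s.
have FH : `|F t - F 0| <= H t - H 0.
  apply: dist_le_of_local_dist_le => //.
    move=> u w u0 uw wt; apply: ler_sum => j _; rewrite ler_wpM2l//.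
    by rewrite -subr_ge0; apply: le_trans (dom j u0 uw (le_trans wt tT)).
  have within_T u : 0 <= u <= t -> 0 <= u <= T.
    by move=> /andP[-> ut]; rewrite (le_trans ut tT).
  move=> c c0t; have c0T := within_T _ c0t.
  apply: filterS (chain_local_expansion c0T eps0 (dg _)) => s + s0t.
  have s0T := within_T _ s0t; move=> /(_ s0T) gE.
  rewrite comonotone_sum_dist//; under eq_bigr do rewrite mulrDl.
  rewrite big_split /=.
  have -> : F s - F c =
      (g (X s) - g (X c) - \sum_j (om j s - om j c) * vf_apply (V j) g (X c))
      + \sum_j (om j s - om j c) * (vf_apply (V j) g (X c) - a j).
    under [X in _ = _ + X]eq_bigr do rewrite mulrBr.
    rewrite sumrB addrA subrK /F.
    have -> : \sum_j (om j s - om j c) * a j =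
        \sum_j a j * om j s - \sum_j a j * om j c.
      by rewrite -sumrB; apply: eq_bigr => j _; rewrite mulrC mulrBr.
    lra.
  rewrite (le_trans (ler_normD _ _))// [leLHS]addrC lerD//.
    rewrite (le_trans (ler_norm_sum _ _ _))//; apply: ler_sum => j _.
    by rewrite normrM mulrC ler_pM// ?driver_dist_le ?gK.
  by rewrite (le_trans gE)// total_dist// mulr_sumr.
have -> : g (X t) - g x - \sum_j a j * (om j t - om j 0) = F t - F 0.
  under eq_bigr do rewrite mulrBr.
  by rewrite sumrB /F X0; lra.
rewrite (le_trans FH)// /H -sumrB.
under eq_bigr do rewrite -mulrBr mulrDl.
rewrite big_split /= lerD2l -mulr_sumr -tvB /eps -mulrA ler_piMr ?(ltW e0)//.
by rewrite mulrC ler_pdivrMr ?mul1r; lra.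
Qed.

End expansion_along_solution.

(** * Growth of the weight along a solution *)

Lemma vf_apply_ln (R : realType) (n : nat) (Y : 'rV[R]_n -> 'rV[R]_n)
    (g : 'rV[R]_n -> R) (y : 'rV[R]_n) :
  0 < g y -> differentiable (g : 'rV[R]_n -> R^o) y ->
  differentiable ((@ln R \o g) : 'rV[R]_n -> R^o) y /\
  vf_apply Y (@ln R \o g) y = vf_apply Y g y / g y.
Proof.
move=> gy0 dg.
have dln : is_derive (g y : R^o) (1 : R^o) (@ln R : R^o -> R^o) (g y)^-1.
  exact: is_derive1_ln.
have difln : differentiable (@ln R : R^o -> R^o) (g y).
  by apply/derivable1_diffP; exact: ex_derive.
split; first exact: differentiable_comp.
rewrite /vf_apply diff_comp//= diff1E//= derive1E derive_val.
by [].
Qed.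

Section weight_along_solution.
Context {R : realType} {n d : nat}.
Variables (V : 'I_d.+1 -> 'rV[R]_n -> 'rV[R]_n) (om v : 'I_d.+1 -> R -> R).
Variables (T : R) (x : 'rV[R]_n) (X : R -> 'rV[R]_n).
Hypothesis T0 : 0 <= T.
Hypothesis contV : forall j, continuous (V j).
Hypothesis solX : is_solution V om T x X.
Hypothesis dom : forall j, dominates_increments 0 T (v j) (om j).
Variables (psi : 'rV[R]_n -> R) (C : R).
Hypothesis psi_gt0 : forall y, 0 < psi y.
Hypothesis dpsi : forall y, differentiable (psi : 'rV[R]_n -> R^o) y.
Hypothesis C0 : 0 <= C.
Hypothesis bound1 : forall y j, `|vf_apply (V j) psi y| <= C * psi y.

Let len t := \sum_j (v j t - v j 0).

Let len_le t : 0 <= t <= T -> len t <= len T.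
Proof.
move=> /andP[t0 tT]; rewrite -subr_ge0 /len -sumrB; apply: sumr_ge0 => j _.
have := dom j t0 tT (lexx T); have := normr_ge0 (om j T - om j t); lra.
Qed.

(** The derivatives of [ln psi] are bounded by [C], so that the mean value
    inequality takes the place of a Gronwall argument. *)
Lemma weight_growth t : 0 <= t <= T ->
  psi (X t) <= expR (C * len t) * psi x.
Proof.
move=> t0T.
have := chain_increment_le contV solX dom (g := @ln R \o psi) (a := fun=> 0)
  (K := fun=> C) t0T 
    (fun y => (vf_apply_ln (fun=> 0) (psi_gt0 y) (dpsi y)).1).
rewrite big1 ?subr0; last by move=> j _; rewrite mul0r.
rewrite -mulr_sumr -/(len t) /= => /(_ _)/(le_trans (ler_norm _)) H.
have {}H : ln (psi (X t)) - ln (psi x) <= C * len t.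
  apply: H => j u _; rewrite subr0 (vf_apply_ln _ (psi_gt0 _) (dpsi _)).2 normrM normfV.
  by rewrite ler_pdivrMr ?normr_gt0 ?gt_eqF// [X in C * X]gtr0_norm.
have expln y : psi y = expR (ln (psi y)) by rewrite lnK ?posrE.
by rewrite (expln x) (expln (X t)) -expRD ler_expR; lra.
Qed.

Hypothesis dVpsi : forall (j : 'I_d) y,
  differentiable (vf_apply (V (lift ord0 j)) psi : 'rV[R]_n -> R^o) y.
Hypothesis bound2 : forall y (i : 'I_d.+1) (j : 'I_d),
  `|vf_apply (V i) (vf_apply (V (lift ord0 j)) psi) y| <= C * psi y.

Let M := expR (C * len T) * psi x.

Let psi_le t : 0 <= t <= T -> psi (X t) <= M.
Proof.
move=> t0T; apply: le_trans (weight_growth t0T) _.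
by apply: ler_wpM2r; [exact: ltW | rewrite ler_expR ler_wpM2l// len_le].
Qed.

Lemma directional_weight_oscillation (j : 'I_d) t : 0 <= t <= T ->
  `|vf_apply (V (lift ord0 j)) psi (X t) - vf_apply (V (lift ord0 j)) psi x|
    <= C * M * len T.
Proof.
move=> t0T.
have := chain_increment_le contV solX dom (a := fun=> 0)
  (K := fun=> C * M) t0T (dVpsi j).
rewrite big1 ?subr0; last by move=> i _; rewrite mul0r.
rewrite -mulr_sumr -/(len t) => H; apply: le_trans (H _) _.
  move=> i u /andP[u0 ut]; rewrite subr0 (le_trans (bound2 _ _ _))// ler_wpM2l//.
  by apply: psi_le; rewrite u0 (le_trans ut)//; case/andP: t0T.
rewrite ler_wpM2l// ?len_le// mulr_ge0// /M mulr_ge0 ?expR_ge0//.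
exact: ltW.
Qed.

(** In a noise direction, [V_j psi] is compared with its value at [x], from
    which it has not moved far; in the time direction, [V_0 psi] is compared
    with 0, since nothing is known about its derivatives. *)
Lemma weight_second_order :
  psi (X T) <= psi x
    + \sum_(j < d) vf_apply (V (lift ord0 j)) psi x
                   * (om (lift ord0 j) T - om (lift ord0 j) 0)
    + C * M * ((v ord0 T - v ord0 0)
               + len T * \sum_(j < d) (v (lift ord0 j) T - v (lift ord0 j) 0)).
Proof.
pose a (i : 'I_d.+1) :=
  if unlift ord0 i is Some j then vf_apply (V (lift ord0 j)) psi x else 0.
pose K (i : 'I_d.+1) :=
  if unlift ord0 i is Some j then C * M * len T else C * M.
have T0T : 0 <= T <= T by rewrite T0 lexx.
have H : forall i u, 0 <= u <= T -> `|vf_apply (V i) psi (X u) - a i| <= K i.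
  move=> i u u0T; rewrite /a /K; case: unliftP => [j ->|->].
    exact: directional_weight_oscillation.
  by rewrite subr0 (le_trans (bound1 _ _))// ler_wpM2l// psi_le.
have := chain_increment_le contV solX dom T0T dpsi H.
rewrite !big_ord_recl /a /K unlift_none mul0r add0r.
under eq_bigr do rewrite liftK; under [X in _ <= _ + X]eq_bigr do rewrite liftK.
rewrite -mulr_sumr; move=> /(le_trans (ler_norm _)).
by rewrite mulrDr mulrA; lra.
Qed.

End weight_along_solution.

(** * Rescaled cubature paths *)

Lemma total_variation_dominates (R : realType) (a b : R) (f : R -> R) :
  bounded_variation a b f ->
  dominates_increments a b (fun s => fine (total_variation a s f)) f.
Proof.
move=> bvf u w au uw wb.
have aw := le_trans au uw.
have finw : total_variation a w f \is a fin_num.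
  by apply/bounded_variationP => //; exact: bounded_variationl bvf.
have finu : total_variation a u f \is a fin_num.
  apply/bounded_variationP => //; apply: bounded_variationl bvf => //.
  exact: le_trans uw wb.
rewrite -lee_fin EFinB !fineK// (total_variationD f au uw) addeAC subee// add0e.
exact: total_variation_ge.
Qed.

Section scaled_paths.
Context {R : realType} {d : nat}.
Variables (om : 'I_d.+1 -> R -> R).
Hypothesis bv : forall j, bounded_variation 0 1 (om j).

Definition scaled_variation (Dt : R) (j : 'I_d.+1) (s : R) : R :=
  if j == ord0 then s
  else Num.sqrt Dt * fine (total_variation 0 (s / Dt) (om j)).

Lemma scaled_variation_dominates Dt j : 0 < Dt ->
  dominates_increments 0 Dt (scaled_variation Dt j) (scaled_path om Dt j).
Proof.
move=> Dt0 u w u0 uw wDt; rewrite /scaled_variation /scaled_path.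
case: ifP => _; first by rewrite ger0_norm ?subr_ge0.
rewrite -!mulrBr normrM ger0_norm ?sqrtr_ge0// ler_wpM2l ?sqrtr_ge0//.
apply: (total_variation_dominates (bv j)).
- by rewrite divr_ge0// ltW.
- by rewrite ler_pM2r// invr_gt0.
- by rewrite ler_pdivrMr// mul1r.
Qed.

Lemma scaled_variation_total Dt j : 0 < Dt ->
  scaled_variation Dt (lift ord0 j) Dt - scaled_variation Dt (lift ord0 j) 0
  = Num.sqrt Dt * fine (total_variation 0 1 (om (lift ord0 j))).
Proof.
move=> Dt0; rewrite /scaled_variation /= mul0r total_variationxx mulr0 subr0.
by rewrite divff// gt_eqF.
Qed.

Lemma scaled_path_total Dt j : 0 < Dt -> om (lift ord0 j) 0 = 0 ->
  scaled_path om Dt (lift ord0 j) Dt - scaled_path om Dt (lift ord0 j) 0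
  = Num.sqrt Dt * om (lift ord0 j) 1.
Proof.
move=> Dt0 om0; rewrite /scaled_path /= mul0r om0 mulr0 subr0.
by rewrite divff// gt_eqF.
Qed.

End scaled_paths.

(** * First moments of a cubature formula *)

Lemma normal_prob_symmetric (R : realType) (sigma : R) (A : set R) :
  sigma != 0 -> measurable A ->
  normal_prob 0 sigma (-%R @^-1` A) = normal_prob 0 sigma A.
Proof.
move=> s0 mA; rewrite /normal_prob.
have mN : measurable_fun setT (-%R : measurableTypeR R -> measurableTypeR R).
  exact: oppr_measurable.
have mpdf : measurable_fun setT (fun x => (normal_pdf 0 sigma x)%:E).
  apply/measurable_EFinP.
  exact: measurable_normal_pdf.
transitivity (\int[pushforward lebesgue_measure
    (-%R : _ -> measurableTypeR R)]_(x in A) (normal_pdf 0 sigma x)%:E)%E.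
  rewrite (ge0_integral_pushforward mN)//=.
  - apply: eq_integral => x _ /=; congr EFin.
    by rewrite !normal_pdfE// /normal_fun !subr0 sqrrN.
  - exact: measurable_funS mpdf.
  - by move=> x _; rewrite lee_fin normal_pdf_ge0.
by apply: eq_measure_integral => S mS _; exact: lebesgue_measureN.
Qed.

(** The positive and negative parts of [Y] have the same integral. That
    the expectation is a real number excludes the case of two infinite parts,
    whose difference is conventionally [-oo]. *)
Lemma expectation_symmetric d (T : measurableType d) (R : realType)
    (P : probability T R) (Y : {RV P >-> R}) (r : R) :
  (forall A : set R, measurable A -> P (Y @^-1` (-%R @^-1` A)) = P (Y @^-1` A)) ->
  ('E_P[Y] = r%:E)%E -> r = 0.
Proof.
move=> symY; rewrite expectation_def integralE.
have mY : measurable_fun setT (Y : T -> R) by exact: measurable_funP.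
have mNY : measurable_fun setT (fun w => - Y w : R) by exact: measurableT_comp.
pose pos (y : R) := (Num.max y 0)%:E.
have mpos : measurable_fun setT pos.
  by apply/measurable_EFinP; exact: measurable_maxr.
have pos0 : {in setT, forall y, (0 <= pos y)%E}.
  by move=> y _; rewrite lee_fin le_max lexx orbT.
have Epos : (\int[P]_w ((fun w => (Y w)%:E)^\+ w) =
             \int[pushforward P Y]_y pos y)%E.
  rewrite (ge0_integral_pushforward mY)//.
  by rewrite preimage_setT; apply: eq_integral => w _; rewrite ?funeposE ?funenegE /pos /= EFin_max.
have Eneg : (\int[P]_w ((fun w => (Y w)%:E)^\- w) =
             \int[pushforward P (fun w => (- Y w)%R)]_y pos y)%E.
  rewrite (ge0_integral_pushforward mNY)//.
  by rewrite preimage_setT; apply: eq_integral => w _; rewrite ?funeposE ?funenegE /pos /= EFin_max.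
have -> : (\int[P]_w ((fun w => (Y w)%:E)^\- w) =
           \int[P]_w ((fun w => (Y w)%:E)^\+ w))%E.
  rewrite Epos Eneg; apply: eq_measure_integral => A mA _.
  exact: symY.
case: (integral _ _ _) => [q|//|//].
by rewrite -EFinB subrr => -[].
Qed.

Section cubature_moments.
Context {dO : measure_display} {Omega : measurableType dO} {R : realType}.
Context {P : probability Omega R} {d m N : nat}.
Variables (B : 'I_d -> R -> {RV P >-> R}).
Variables (lam : 'I_N -> R) (om : 'I_N -> 'I_d.+1 -> R -> R).
Hypothesis cub : is_cubature P B m lam om.

Let one (t : R) : {RV P >-> R} := cst 1.

Let one_iterated : stratonovich_iterated B [::] one.
Proof. by apply: stratonovich_iterated_nil. Qed.

Lemma cubature_weight_sum : \sum_(i < N) lam i = 1.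
Proof.
have := cub_moments cub (leq0n m : (multi_degree (Nil 'I_d.+1) <= m)%N)
  one_iterated.
rewrite expectation_cst => -[->].
by apply: eq_bigr => i _; rewrite mulr1.
Qed.

(** The trapezoidal sums of the constant 1 against [B j] telescope, so the
    iterated Stratonovich integral is [B j t - B j 0], a centred Gaussian. *)
Lemma cubature_first_moment (j : 'I_d) : is_brownian_motion P B -> (1 <= m)%N ->
  \sum_(i < N) lam i * om i (lift ord0 j) 1 = 0.
Proof.
move=> bmB m1.
pose J t : {RV P >-> R} := (B j t : {mfun _ >-> _}) - B j 0.
have JE t w : J t w = B j t w - B j 0 w by [].
have J_iterated : stratonovich_iterated B [:: lift ord0 j] J.
  apply: (stratonovich_iterated_rcons (al := [::]) one_iterated).
  move=> t /andP[t0 _] eps eps0.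
  have PF := partitions_proper t0; apply: cvg_near_cst.
  exists 1 => //= s [abs _].
  rewrite (_ : [set w | _] = set0) ?measure0//; apply/seteqP; split => // w /=.
  suff -> : trapezoid_sum one (with_time B (lift ord0 j)) 0 t s w = J t w.
    by rewrite subrr normr0 leNgt eps0.
  rewrite JE -(telescope_node (fun u => B j u w) abs) /trapezoid_sum.
  apply: eq_bigr => k _; rewrite /with_time liftK /=.
  by rewrite -mulr2n divff ?mul1r.
have J_deg : (multi_degree [:: lift ord0 j] <= m)%N.
  by rewrite /multi_degree /= !addn0.
have := cub_moments cub J_deg J_iterated.
under [X in X%:E]eq_bigr do
  rewrite /path_iterated /= RS_integral_cst// (cub_start cub) subr0.
apply: expectation_symmetric => A mA.
have gauss S : measurable S -> P (J 1 @^-1` S) = normal_prob 0 1 S.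
  by move=> mS; have := bm_gaussian bmB j (lexx 0) ltr01 (lexx 1) mS;
    rewrite subr0 sqrtr1.
rewrite !gauss ?normal_prob_symmetric// -[X in measurable X]setTI.
exact: oppr_measurable.
Qed.

End cubature_moments.

(** * One step along a single cubature path *)

Section one_cubature_path.
Context {R : realType} {n d : nat}.
Variables (V : 'I_d.+1 -> 'rV[R]_n -> 'rV[R]_n) (om : 'I_d.+1 -> R -> R).
Variables (K Dt : R) (x : 'rV[R]_n) (X : R -> 'rV[R]_n).
Hypothesis Dt0 : 0 < Dt.
Hypothesis contV : forall j, continuous (V j).
Hypothesis bv : forall j, bounded_variation 0 1 (om j).
Hypothesis om0 : forall j, om j 0 = 0.
Hypothesis variation_le :
  \sum_(j < d) fine (total_variation 0 1 (om (lift ord0 j))) <= K.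
Hypothesis solX : is_solution V (scaled_path om Dt) Dt x X.
Variables (psi : 'rV[R]_n -> R) (C : R).
Hypothesis psi_gt0 : forall y, 0 < psi y.
Hypothesis dpsi : forall y, differentiable (psi : 'rV[R]_n -> R^o) y.
Hypothesis C0 : 0 <= C.
Hypothesis bound1 : forall y j, `|vf_apply (V j) psi y| <= C * psi y.

Let kappa : R := \sum_(j < d) fine (total_variation 0 1 (om (lift ord0 j))).

Let kappa0 : 0 <= kappa.
Proof. by apply: sumr_ge0 => j _; rewrite fine_ge0// total_variation_ge0. Qed.

Let r := Num.sqrt Dt.

Let r0 : 0 < r. Proof. by rewrite sqrtr_gt0. Qed.

Let rr : r * r = Dt. Proof. by rewrite -expr2 sqr_sqrtr// ltW. Qed.

Let dom j :
  dominates_increments 0 Dt (scaled_variation om Dt j) (scaled_path om Dt j).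
Proof. exact: scaled_variation_dominates. Qed.

Let noise_length : \sum_(j < d) (scaled_variation om Dt (lift ord0 j) Dt
    - scaled_variation om Dt (lift ord0 j) 0) = r * kappa.
Proof.
rewrite mulr_sumr; apply: eq_bigr => j _; exact: scaled_variation_total.
Qed.

Let time_length : scaled_variation om Dt ord0 Dt
  - scaled_variation om Dt ord0 0 = Dt.
Proof. by rewrite /scaled_variation eqxx subr0. Qed.

Let length : \sum_(j < d.+1) (scaled_variation om Dt j Dt
    - scaled_variation om Dt j 0) = Dt + r * kappa.
Proof. by rewrite big_ord_recl time_length noise_length. Qed.

(** For [1 <= Dt] the noise length [r * kappa] is at most [Dt * kappa]. *)
Lemma long_step_weight_le : 1 <= Dt ->
  psi (X Dt) <= expR (C * (1 + K) * Dt) * psi x.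
Proof.
move=> Dt1; have DtDt : 0 <= Dt <= Dt by rewrite (ltW Dt0) lexx.
have := weight_growth contV solX dom psi_gt0 dpsi bound1 DtDt.
rewrite length => /le_trans; apply; rewrite ler_wpM2r ?(ltW (psi_gt0 _))//.
rewrite ler_expR -mulrA ler_wpM2l// mulrDl mul1r lerD2l.
have r_le : r <= Dt.
  rewrite -[leRHS]rr -[leLHS]mulr1 ler_wpM2l ?(ltW r0)//.
  by rewrite -sqrtr1 ler_sqrt// ltW.
by rewrite mulrC ler_pM// ltW.
Qed.

Hypothesis dVpsi : forall (j : 'I_d) y,
  differentiable (vf_apply (V (lift ord0 j)) psi : 'rV[R]_n -> R^o) y.
Hypothesis bound2 : forall y (i : 'I_d.+1) (j : 'I_d),
  `|vf_apply (V i) (vf_apply (V (lift ord0 j)) psi) y| <= C * psi y.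

(** For [Dt <= 1] the length of the path is bounded, which bounds the growth
    factor, and the second-order term is the product of two lengths of order
    [r], hence of order [Dt]. *)
Lemma short_step_weight_le : Dt <= 1 ->
  psi (X Dt) <= psi x
    + r * \sum_(j < d) vf_apply (V (lift ord0 j)) psi x * om (lift ord0 j) 1
    + C * expR (C * (1 + K)) * (1 + (1 + K) * K) * Dt * psi x.
Proof.
move=> Dt1.
have := weight_second_order (ltW Dt0) contV solX dom psi_gt0 dpsi C0 bound1
  dVpsi bound2.
rewrite time_length noise_length length => /le_trans; apply.
have -> : \sum_(j < d) vf_apply (V (lift ord0 j)) psi x *
      (scaled_path om Dt (lift ord0 j) Dt - scaled_path om Dt (lift ord0 j) 0)
    = r * \sum_(j < d) vf_apply (V (lift ord0 j)) psi x * om (lift ord0 j) 1.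
  rewrite mulr_sumr; apply: eq_bigr => j _.
  by rewrite scaled_path_total// mulrCA.
rewrite lerD2l.
have r1 : r <= 1 by rewrite -sqrtr1 ler_wsqrtr.
have length_le : Dt + r * kappa <= 1 + K.
  by rewrite lerD// -[leRHS]mul1r ler_pM// ltW.
have length0 : 0 <= Dt + r * kappa by rewrite addr_ge0 ?mulr_ge0// ltW.
have area_le : (Dt + r * kappa) * (r * kappa) <= Dt * ((1 + K) * K).
  have -> : (Dt + r * kappa) * (r * kappa) = Dt * ((r + kappa) * kappa).
    by rewrite -rr; ring.
  rewrite ler_wpM2l ?(ltW Dt0)// ler_pM//; first by rewrite addr_ge0// ltW.
  exact: lerD.
have exp_le : expR (C * (Dt + r * kappa)) <= expR (C * (1 + K)).
  by rewrite ler_expR ler_wpM2l.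
rewrite -!(mulrA C) ler_wpM2l//.
rewrite (_ : _ * _ = expR (C * (Dt + r * kappa)) *
  (Dt + (Dt + r * kappa) * (r * kappa)) * psi x); last by ring.
rewrite ler_wpM2r ?(ltW (psi_gt0 _))// -mulrA.
apply: ler_pM => //.
  by rewrite addr_ge0 ?(ltW Dt0)// mulr_ge0// mulr_ge0// ltW.
by rewrite [leRHS]mulrDl mul1r lerD2l [leRHS]mulrC.
Qed.

End one_cubature_path.

(** * The stability estimate *)

Theorem theorem4p1 (R : realType) (n d m N : nat) (hd : (1 <= d)%N)
  (hm : (1 <= m)%N)
  (dO : measure_display) (Omega : measurableType dO) (P : probability Omega R)
  (B : 'I_d -> R -> {RV P >-> R}) (hB : is_brownian_motion P B)
  (lam : 'I_N -> R) (om : 'I_N -> 'I_d.+1 -> R -> R)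
  (hcub : is_cubature P B m lam om)
  (V : 'I_d.+1 -> 'rV[R]_n -> 'rV[R]_n)
  (hV : forall j, continuous (V j))
  (X : 'I_N -> R -> 'rV[R]_n -> R -> 'rV[R]_n)
  (hX : forall i Dt x, 0 < Dt ->
     is_solution V (scaled_path (om i) Dt) Dt x (X i Dt x))
  (psi : 'rV[R]_n -> R) (hpsi : admissible_weight psi)
  (hD1 : forall x, differentiable (psi : 'rV[R]_n -> R^o) x)
  (hD2 : forall (j : 'I_d) x,
     differentiable (vf_apply (V (lift ord0 j)) psi : 'rV[R]_n -> R^o) x)
  (C : R) (hC : 0 < C)
  (hbound : forall (x : 'rV[R]_n) (i : 'I_d.+1) (j : 'I_d),
     `|vf_apply (V i) (vf_apply (V (lift ord0 j)) psi) x|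
       + `|vf_apply (V i) psi x| <= C * psi x) :
  exists Ct : R, 0 < Ct /\
    forall (Dt : R) (x : 'rV[R]_n), 0 < Dt ->
      Q lam X Dt psi x <= expR (Ct * Dt) * psi x.
Proof.
have [psi_gt0 _] := hpsi.
have bound1 y i : `|vf_apply (V i) psi y| <= C * psi y.
  by apply: le_trans (hbound y i (Ordinal hd)); rewrite lerDr.
have bound2 y i j :
    `|vf_apply (V i) (vf_apply (V (lift ord0 j)) psi) y| <= C * psi y.
  by apply: le_trans (hbound y i j); rewrite lerDl.
have bv i j : bounded_variation 0 1 (om i j) by exact: (cub_bounded_variation hcub).
have om0 i j : om i j 0 = 0 by exact: (cub_start hcub).
have lam0 i : 0 <= lam i by rewrite ltW// (cub_weight_gt0 hcub).
pose kappa i : R := \sum_(j < d) fine (total_variation 0 1 (om i (lift ord0 j))).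
have kappa0 i : 0 <= kappa i.
  by apply: sumr_ge0 => j _; rewrite fine_ge0// total_variation_ge0.
pose K := \sum_(i < N) kappa i.
have kappa_le i : kappa i <= K by rewrite /K (bigD1 i)//= lerDl sumr_ge0.
have K0 : 0 <= K by apply: sumr_ge0.
pose C1 := C * (1 + K).
pose C2 := C * expR (C * (1 + K)) * (1 + (1 + K) * K).
have C10 : 0 < C1 by rewrite mulr_gt0//; lra.
have C20 : 0 < C2.
  rewrite !mulr_gt0 ?expR_gt0// ltr_wpDr// mulr_ge0//; lra.
exists (C1 + C2); split=> [|Dt x Dt0]; first by rewrite addr_gt0.
have psix := psi_gt0 x.
have [Dt1|/ltW Dt1] := leP Dt 1.
  (* The paths are averaged: the terms of order [Num.sqrt Dt] cancel. *)
  pose first_order i :=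
    \sum_(j < d) vf_apply (V (lift ord0 j)) psi x * om i (lift ord0 j) 1.
  have mean0 : \sum_(i < N) lam i * first_order i = 0.
    under eq_bigr do rewrite mulr_sumr; rewrite exchange_big big1//= => j _.
    under eq_bigr do rewrite mulrCA.
    by rewrite -mulr_sumr (cubature_first_moment hcub)// mulr0.
  apply: (@le_trans _ _ (\sum_(i < N) lam i *
      (psi x + Num.sqrt Dt * first_order i + C2 * Dt * psi x))).
    apply: ler_sum => i _; rewrite ler_wpM2l//.
    apply: (short_step_weight_le Dt0 hV (bv i) (om0 i) (kappa_le i)
      (hX i Dt x Dt0)) => //; exact: ltW.
  rewrite (eq_bigr (fun i => lam i * (psi x + C2 * Dt * psi x)
      + Num.sqrt Dt * (lam i * first_order i))); last by move=> i _; ring.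
  rewrite big_split /= -mulr_suml -mulr_sumr mean0 mulr0 addr0.
  rewrite (cubature_weight_sum hcub) mul1r -{1}(mul1r (psi x)) -mulrDl.
  rewrite ler_wpM2r ?(ltW psix)// (le_trans (expR_ge1Dx _))// ler_expR.
  by rewrite ler_wpM2r ?(ltW Dt0)//; lra.
(* For a long step, every path satisfies the bound by itself. *)
apply: (@le_trans _ _ (\sum_(i < N) lam i * (expR (C1 * Dt) * psi x))).
  apply: ler_sum => i _; rewrite ler_wpM2l//.
  by apply: (long_step_weight_le Dt0 hV (bv i) (kappa_le i) (hX i Dt x Dt0)) => //;
    exact: ltW.
rewrite -mulr_suml (cubature_weight_sum hcub) mul1r ler_wpM2r ?(ltW psix)//.
by rewrite ler_expR ler_wpM2r ?(ltW Dt0)//; lra.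
Qed.
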